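(* Let $a,b,c,d,e,f,n$ be complex parameters and let $$F(n,k,a):=\frac{(d)_{k+a}\,(b)_{k+e}}{(n+a)_{k+f}\,(n)_{k+c}},\qquad \mathfrak f(n,a):=\sum_{k=0}^{\infty}F(n,k,a),$$ and let $g_5,g_6$ be the associated functions defined in the context. Suppose that the standing assumptions (i)--(iv) listed in the context hold. Then the acceleration identity (of iteration pattern $(1,1)$) $$\mathfrak f(n,a)=\sum_{j=0}^{\infty}\left(\prod_{i=0}^{j-1}g_6(n+i,a+i)\right)g_5(n+j,a+j)$$ holds.
   Context: Rising factorials with arbitrary index are $(x)_y=\Gamma(x+y)/\Gamma(x)$; an empty product is $1$. The parameters $b,c,d,e,f$ are fixed throughout, while $n$ and $a$ are shifted by integers. Put $A=a+d$, $B=b+e$, $C=n+c$, $D=n+a+f$, $s=A+B-C-D=b-c+d+e-f-2n$ (all functions of $(n,a)$), and define $$p_1(n,a)=(D-A)(A-C)(C-B)(D-B),\qquad p_2(n,a)=n(a+n)\,s\,(s+1),$$ $$R(n,k,a)=n(a+n)\big(sk+s(C+D-1)-AB+CD\big),$$ $$p_3(n,a)=b+e-n-a-f,\qquad p_4(n,a)=(n+a)(a+d-n-c+1),\qquad \mathcal R(n,k,a)=(a+n)(c+k+n-1),$$ $$G(n,k,a)=R(n,k,a)F(n,k,a),\qquad \mathcal G(n,k,a)=\mathcal R(n,k,a)F(n,k,a).$$ (These are the data of the first-order recurrences $p_1F(n+1,k,a)+p_2F(n,k,a)=G(n,k+1,a)-G(n,k,a)$ and $p_3F(n,k,a+1)+p_4F(n,k,a)=\mathcal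 G(n,k+1,a)-\mathcal G(n,k,a)$ produced by Zeilberger's algorithm.) Set $$g_1=-\frac{G(n,0,a)}{p_2(n,a)},\quad g_2=-\frac{p_1(n,a)}{p_2(n,a)},\quad g_3=-\frac{\mathcal G(n,0,a)}{p_4(n,a)},\quad g_4=-\frac{p_3(n,a)}{p_4(n,a)},$$ $$g_5(n,a)=g_1(n,a)+g_2(n,a)\,g_3(n+1,a),\qquad g_6(n,a)=g_2(n,a)\,g_4(n+1,a).$$ Standing assumptions, required for every integer $j\ge 0$: (i) all Gamma functions occurring in $F(n+j,k,a+j)$ and $F(n+j+1,k,a+j)$, $k\ge 0$, are evaluated away from their poles, and $p_2(n+j,a+j)\neq0$, $p_4(n+j+1,a+j)\ne 0$; (ii) the series defining $\mathfrak f(n+j,a+j)$ and $\mathfrak f(n+j+1,a+j)$ converge; (iii) $\lim_{k\to\infty}G(n+j,k,a+j)=0$ and $\lim_{k\to\infty}\mathcal G(n+j+1,k,a+j)=0$; (iv) $\lim_{m\to\infty}\Big(\prod_{i=0}^{m}g_6(n+i,a+i)\Big)\mathfrak f(n+m+1,a+m+1)=0$. *)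

(* Defs.v *)
From Stdlib Require Import Reals Factorial.
From Coquelicot Require Import Coquelicot.

Open Scope C_scope.

(* Stdlib reals with Coquelicot's complex numbers.  The coercion [RtoC] is used
   throughout, so [INR k] below is a complex number.  Division is total
   ([/ 0 = 0]); so are [Clim_seq] and [CSeries], which are meaningful only for
   convergent sequences and series. *)

Definition Cexp (z : C) : C :=
  ((exp (Re z) * cos (Im z))%R, (exp (Re z) * sin (Im z))%R).

(* The empty product is [Cprod u 0 = 1], and [Cprod u m] has factors
   [u 0, ..., u (m - 1)]. *)
Fixpoint Cprod (u : nat -> C) (m : nat) : C :=
  match m with
  | O => 1
  | S m' => Cprod u m' * u m'
  end.

Definition Clim_seq (u : nat -> C) : C :=
  (real (Lim_seq (fun m => Re (u m))), real (Lim_seq (fun m => Im (u m)))).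

Definition CSeries (u : nat -> C) : C :=
  (Series (fun k => Re (u k)), Series (fun k => Im (u k))).

(* Euler's definition
     Gamma z = lim_m  m! m^z / (z (z + 1) ... (z + m)),
   valid at every complex [z] which is not a nonpositive integer.
   The power is [m^z = exp (z ln m)]; the term [m = 0] is irrelevant. *)
Definition Gamma (z : C) : C :=
  Clim_seq (fun m =>
    INR (fact m) * Cexp (z * ln (INR m)) / Cprod (fun i => z + INR i) (S m)).

Definition not_Gamma_pole (z : C) : Prop := forall m : nat, z <> - INR m.

(* Rising factorial (x)_y with arbitrary complex index. *)
Definition rising (x y : C) : C := Gamma (x + y) / Gamma x.

Definition rising_regular (x y : C) : Prop :=
  not_Gamma_pole x /\ not_Gamma_pole (x + y).

Definition F (b c d e f n : C) (k : nat) (a : C) : C :=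
  (rising d (INR k + a) * rising b (INR k + e)) /
  (rising (n + a) (INR k + f) * rising n (INR k + c)).

(* No Gamma function occurring in [F b c d e f n k a], [k >= 0], is evaluated
   at a pole. *)
Definition F_regular (b c d e f n a : C) : Prop :=
  forall k : nat,
    rising_regular d (INR k + a) /\ rising_regular b (INR k + e) /\
    rising_regular (n + a) (INR k + f) /\ rising_regular n (INR k + c).

Definition frakf (b c d e f n a : C) : C :=
  CSeries (fun k => F b c d e f n k a).

Definition p1 (b c d e f n a : C) : C :=
  let A := a + d in let B := b + e in let C := n + c in let D := n + a + f in
  (D - A) * (A - C) * (C - B) * (D - B).

Definition p2 (b c d e f n a : C) : C :=
  let A := a + d in let B := b + e in let C := n + c in let D := n + a + f in
  let s := A + B - C - D in
  n * (a + n) * s * (s + 1).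

Definition Rcoef (b c d e f n : C) (k : nat) (a : C) : C :=
  let A := a + d in let B := b + e in let C := n + c in let D := n + a + f in
  let s := A + B - C - D in
  n * (a + n) * (s * INR k + s * (C + D - 1) - A * B + C * D).

Definition p3 (b c d e f n a : C) : C := b + e - n - a - f.

Definition p4 (b c d e f n a : C) : C := (n + a) * (a + d - n - c + 1).

Definition calR (b c d e f n : C) (k : nat) (a : C) : C :=
  (a + n) * (c + INR k + n - 1).

Definition G (b c d e f n : C) (k : nat) (a : C) : C :=
  Rcoef b c d e f n k a * F b c d e f n k a.

Definition calG (b c d e f n : C) (k : nat) (a : C) : C :=
  calR b c d e f n k a * F b c d e f n k a.

Definition g1 (b c d e f n a : C) : C :=
  - (G b c d e f n 0 a / p2 b c d e f n a).

Definition g2 (b c d e f n a : C) : C :=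
  - (p1 b c d e f n a / p2 b c d e f n a).

Definition g3 (b c d e f n a : C) : C :=
  - (calG b c d e f n 0 a / p4 b c d e f n a).

Definition g4 (b c d e f n a : C) : C :=
  - (p3 b c d e f n a / p4 b c d e f n a).

Definition g5 (b c d e f n a : C) : C :=
  g1 b c d e f n a + g2 b c d e f n a * g3 b c d e f (n + 1) a.

Definition g6 (b c d e f n a : C) : C :=
  g2 b c d e f n a * g4 b c d e f (n + 1) a.

(* Convergence in C; Coquelicot has several normed structures on [C], and here
   it is a module over itself. *)
Definition ex_Cseries (u : nat -> C) : Prop :=
  @ex_series C_AbsRing C_NormedModule u.

Definition is_Cseries (u : nat -> C) (l : C) : Prop :=
  @is_series C_AbsRing C_NormedModule u l.

Definition is_Clim_seq (u : nat -> C) (l : C) : Prop :=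
  filterlim u eventually (@locally C_UniformSpace l).

(* Main.v *)
Require Import Defs.
From Stdlib Require Import Reals Factorial Lra Lia.
From Coquelicot Require Import Coquelicot.
Open Scope C_scope.

(** Every ratio of neighbouring values of [F], in each of the variables [k], [n]
    and [a], is a rational function, because [Gamma (z + 1) = z * Gamma z].  The
    two first-order recurrences are therefore identities between rational
    functions, and [field] verifies them ([F_recurrence_n], [F_recurrence_a]).

    Summed over [k], the right-hand sides telescope: they leave [- G 0] and
    [- calG 0], since [G] and [calG] tend to 0.  Solving for the sum that is not
    shifted gives, with [f] for [frakf],
<<
      f (n, a)     = g1 (n, a)     + g2 (n, a)     f (n + 1, a),
      f (n + 1, a) = g3 (n + 1, a) + g4 (n + 1, a) f (n + 1, a + 1),
>>
    hence [f (n, a) = g5 (n, a) + g6 (n, a) f (n + 1, a + 1)] ([frakf_step]).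
    Iterating this along the diagonal writes [f (n, a)] as a partial sum of the
    accelerated series plus the remainder that tends to 0 by assumption
    ([iterated_recurrence]).

    The analytic part is the functional equation of Gamma, here the limit of
    Euler's product, whose terms are called [euler_term z m] below.  Comparing
    these terms at [z] and at [z + 1] gives the equation once the limits are
    known to exist ([euler_term_shift], [Gamma_succ]).  They exist because
    consecutive terms have ratio [1 + O (1 / m - 1 / (m + 1))]
    ([euler_ratio_bound]), an error that telescopes to something finite
    ([near_constant_ratio_cvg]).

    The proof never divides by a value of Gamma.  Inversion is total and commutes
    with products even at 0 ([Cinv_mult_total]), so the Gamma factors in the
    denominators of [F] are treated like those in the numerators, and the only
    quantities cancelled are the linear factors produced by the functional
    equation ([F_generic]). *)

(** * Complex arithmetic *)

Lemma Cinv_0 : / (RtoC 0) = 0.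
Proof. unfold Cinv, RtoC; simpl; f_equal; unfold Rdiv; ring. Qed.

Lemma Cinv_mult_total (x y : C) : / (x * y) = / x * / y.
Proof.
  destruct (Ceq_dec x 0) as [->|Hx]; [now rewrite Cmult_0_l, Cinv_0, Cmult_0_l|].
  destruct (Ceq_dec y 0) as [->|Hy]; [now rewrite Cmult_0_r, Cinv_0, Cmult_0_r|].
  field; now split.
Qed.

Lemma INR_S_C (m : nat) : RtoC (INR (S m)) = INR m + 1.
Proof. now rewrite S_INR, RtoC_plus. Qed.

Lemma Cprod_shift (u : nat -> C) (m : nat) :
  Cprod u (S m) = u 0%nat * Cprod (fun i => u (S i)) m.
Proof.
  induction m as [|m IH]; [simpl; ring|].
  change (Cprod u (S (S m))) with (Cprod u (S m) * u (S m)); rewrite IH; simpl; ring.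
Qed.

Lemma Cprod_ext (u v : nat -> C) (m : nat) :
  (forall i, u i = v i) -> Cprod u m = Cprod v m.
Proof. intros H; induction m as [|m IH]; simpl; [| rewrite IH, H]; reflexivity. Qed.

Lemma Cmod_le_components (z : C) : (Cmod z <= Rabs (Re z) + Rabs (Im z))%R.
Proof.
  replace z with (RtoC (Re z) + Ci * RtoC (Im z)) at 1.
  - eapply Rle_trans; [apply Cmod_triangle|].
    rewrite Cmod_mult, !Cmod_R, Cmod_Ci; lra.
  - destruct z as [x y]; unfold Ci, RtoC, Cplus, Cmult; simpl; f_equal; ring.
Qed.

Lemma im_le_Cmod (z : C) : (Rabs (Im z) <= Cmod z)%R.
Proof. eapply Rle_trans; [apply Rmax_r | apply Rmax_Cmod]. Qed.

(** Keeps [z + m] away from 0 for all large [m], uniformly enough to divide the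
    numerator of [euler_ratio_bound] by it. *)
Lemma Cmod_plus_INR_ge (z : C) (m : nat) :
  (2 * Cmod z <= INR m)%R -> (INR m / 2 <= Cmod (z + INR m))%R.
Proof.
  intros H; generalize (Cmod_triangle (z + INR m) (- z)).
  replace (z + INR m + - z) with (RtoC (INR m)) by ring.
  rewrite Cmod_opp, Cmod_R, Rabs_pos_eq by apply pos_INR; lra.
Qed.

(** * Limits and series of complex numbers *)

Lemma is_Clim_seq_components (u : nat -> C) (l : C) :
  is_Clim_seq u l <->
  is_lim_seq (fun m => Re (u m)) (Re l) /\ is_lim_seq (fun m => Im (u m)) (Im l).
Proof.
  unfold is_Clim_seq, is_lim_seq; split.
  - intros H; split; intros P [eps HP];
      destruct (H _ (locally_ball l eps)) as [N HN];
      exists N; intros m Hm; apply HP, (HN m Hm).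
  - intros [H1 H2] P [eps HP].
    destruct (H1 _ (locally_ball (Re l : R_UniformSpace) eps)) as [N1 HN1].
    destruct (H2 _ (locally_ball (Im l : R_UniformSpace) eps)) as [N2 HN2].
    exists (N1 + N2)%nat; intros m Hm; apply HP.
    split; [apply HN1 | apply HN2]; lia.
Qed.

Lemma is_Clim_seq_ext (u v : nat -> C) (l : C) :
  (forall m, u m = v m) -> is_Clim_seq u l -> is_Clim_seq v l.
Proof. apply filterlim_ext. Qed.

Lemma is_Clim_seq_const (l : C) : is_Clim_seq (fun _ => l) l.
Proof. apply filterlim_const. Qed.

Lemma is_Clim_seq_plus (u v : nat -> C) (k l : C) :
  is_Clim_seq u k -> is_Clim_seq v l -> is_Clim_seq (fun m => u m + v m) (k + l).
Proof.
  rewrite !is_Clim_seq_components; intros [H1 H2] [H3 H4]; split.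
  - exact (is_lim_seq_plus' _ _ _ _ H1 H3).
  - exact (is_lim_seq_plus' _ _ _ _ H2 H4).
Qed.

Lemma is_Clim_seq_mult (u v : nat -> C) (k l : C) :
  is_Clim_seq u k -> is_Clim_seq v l -> is_Clim_seq (fun m => u m * v m) (k * l).
Proof.
  rewrite !is_Clim_seq_components; intros [H1 H2] [H3 H4]; split.
  - apply (is_lim_seq_minus' _ _ _ _ (is_lim_seq_mult' _ _ _ _ H1 H3)
             (is_lim_seq_mult' _ _ _ _ H2 H4)).
  - apply (is_lim_seq_plus' _ _ _ _ (is_lim_seq_mult' _ _ _ _ H1 H4)
             (is_lim_seq_mult' _ _ _ _ H2 H3)).
Qed.

Lemma is_Clim_seq_scal (c : C) (u : nat -> C) (l : C) :
  is_Clim_seq u l -> is_Clim_seq (fun m => c * u m) (c * l).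
Proof. apply is_Clim_seq_mult, is_Clim_seq_const. Qed.

Lemma is_Clim_seq_incr_n (u : nat -> C) (N : nat) (l : C) :
  is_Clim_seq u l <-> is_Clim_seq (fun m => u (m + N)%nat) l.
Proof.
  rewrite !is_Clim_seq_components.
  now rewrite (is_lim_seq_incr_n _ N), (is_lim_seq_incr_n (fun m => Im (u m)) N).
Qed.

Lemma is_Clim_seq_Clim_seq (u : nat -> C) (l : C) :
  is_Clim_seq u l -> Clim_seq u = l.
Proof.
  rewrite is_Clim_seq_components; intros [H1 H2]; unfold Clim_seq.
  rewrite (is_lim_seq_unique _ _ H1), (is_lim_seq_unique _ _ H2).
  now destruct l.
Qed.

Lemma is_Clim_seq_unique (u : nat -> C) (k l : C) :
  is_Clim_seq u k -> is_Clim_seq u l -> k = l.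
Proof.
  intros H1 H2.
  now rewrite <- (is_Clim_seq_Clim_seq _ _ H1), (is_Clim_seq_Clim_seq _ _ H2).
Qed.

(** [CSeries] is defined by real and imaginary parts, whereas [ex_Cseries] refers
    to the norm of [C]; the two notions of sum agree since convergence in [C] is
    componentwise. *)
Lemma CSeries_correct (u : nat -> C) : ex_Cseries u -> is_Cseries u (CSeries u).
Proof.
  intros [l Hl].
  enough (CSeries u = l) as -> by exact Hl.
  assert (H : is_Clim_seq (sum_n (G := C_NormedModule) u) l) by exact Hl.
  apply is_Clim_seq_components in H as [H1 H2].
  assert (E : forall m,
    Re (sum_n (G := C_NormedModule) u m) = sum_n (fun k => Re (u k)) m /\
    Im (sum_n (G := C_NormedModule) u m) = sum_n (fun k => Im (u k)) m).
  { induction m as [|m [IH1 IH2]].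
    - now rewrite !sum_O.
    - rewrite !sum_Sn, <- IH1, <- IH2; split; reflexivity. }
  unfold CSeries.
  rewrite (is_series_unique _ (Re l)), (is_series_unique _ (Im l)).
  - now destruct l.
  - refine (is_lim_seq_ext _ _ _ _ H2); intros m; apply E.
  - refine (is_lim_seq_ext _ _ _ _ H1); intros m; apply E.
Qed.

Lemma is_Clim_seq_RtoC (x : nat -> R) (l : R) :
  is_lim_seq x l -> is_Clim_seq (fun m => RtoC (x m)) (RtoC l).
Proof.
  intros H; apply is_Clim_seq_components; split;
    [exact H | apply is_lim_seq_const].
Qed.

Lemma is_lim_seq_inv_INR : is_lim_seq (fun m => / INR m)%R 0.
Proof.
  replace (Finite 0) with (Rbar_inv p_infty) by reflexivity.
  apply is_lim_seq_inv; [apply is_lim_seq_INR | discriminate].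
Qed.

(** [x + M * t] decreases and is bounded below by [- M], so it converges; and so
    does [x], because [M * t] tends to 0. *)
Lemma bounded_variation_cvg (x t : nat -> R) (M : R) :
  is_lim_seq t 0 -> (forall m, 0 <= t m)%R -> (forall m, Rabs (x m) <= M)%R ->
  (forall m, Rabs (x (S m) - x m) <= M * (t m - t (S m)))%R ->
  ex_finite_lim_seq x.
Proof.
  intros Ht Ht0 HM Hx.
  assert (M0 : (0 <= M)%R) by (eapply Rle_trans; [apply Rabs_pos | apply (HM 0%nat)]).
  destruct (ex_finite_lim_seq_decr (fun m => x m + M * t m)%R (- M)%R) as [l Hl].
  - intros m; generalize (Rabs_le_between (x (S m) - x m)%R (M * (t m - t (S m)))%R).
    intros [H _]; specialize (H (Hx m)); lra.
  - intros m; generalize (proj1 (Rabs_le_between _ _) (HM m)) (Ht0 m).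
    intros; nra.
  - exists (l - M * 0)%R.
    apply is_lim_seq_ext with (fun m => (x m + M * t m) - M * t m)%R.
    { intros; ring. }
    apply is_lim_seq_minus'; [exact Hl|].
    apply is_lim_seq_mult'; [apply is_lim_seq_const | exact Ht].
Qed.

(** A discrete Gronwall argument: [1 + h <= exp h] makes [Cmod (u m) * exp (t m)]
    nonincreasing, which bounds [u]; the increments of [u] are then dominated by
    those of a multiple of [t]. *)
Lemma near_constant_ratio_cvg (u : nat -> C) (t : nat -> R) :
  is_lim_seq t 0 -> (forall m, 0 <= t m)%R -> (forall m, t (S m) <= t m)%R ->
  (forall m, Cmod (u (S m) - u m) <= Cmod (u m) * (t m - t (S m)))%R ->
  exists l, is_Clim_seq u l.
Proof.
  intros Ht Ht0 Htd Hu.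
  set (M := (Cmod (u 0%nat) * exp (t 0%nat))%R).
  assert (HM : forall m, (Cmod (u m) * exp (t m) <= M)%R).
  { induction m as [|m IH]; [apply Rle_refl|].
    eapply Rle_trans; [| exact IH].
    assert (H1 : (Cmod (u (S m)) <= Cmod (u m) * exp (t m - t (S m)))%R).
    { replace (u (S m)) with (u m + (u (S m) - u m)) by ring.
      eapply Rle_trans; [apply Cmod_triangle|].
      generalize (Hu m) (Cmod_ge_0 (u m)) (exp_ineq1_le (t m - t (S m))).
      intros; nra. }
    replace (exp (t m)) with (exp (t m - t (S m)) * exp (t (S m)))%R
      by (rewrite <- exp_plus; f_equal; ring).
    rewrite <- Rmult_assoc.
    apply Rmult_le_compat_r; [apply Rlt_le, exp_pos | exact H1]. }
  assert (HM' : forall m, (Cmod (u m) <= M)%R).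
  { intros m; eapply Rle_trans; [| apply (HM m)].
    generalize (Cmod_ge_0 (u m)) (exp_ineq1_le (t m)) (Ht0 m); intros; nra. }
  assert (dt : forall m, (Cmod (u (S m) - u m) <= M * (t m - t (S m)))%R).
  { intros m; eapply Rle_trans; [apply Hu|].
    apply Rmult_le_compat_r; [specialize (Htd m); lra | auto]. }
  destruct (bounded_variation_cvg (fun m => Re (u m)) t M) as [x Hx]; auto.
  { intros m; eapply Rle_trans; [apply re_le_Cmod | auto]. }
  { intros m; eapply Rle_trans; [apply (re_le_Cmod (u (S m) - u m)) | auto]. }
  destruct (bounded_variation_cvg (fun m => Im (u m)) t M) as [y Hy]; auto.
  { intros m; eapply Rle_trans; [apply im_le_Cmod | auto]. }
  { intros m; eapply Rle_trans; [apply (im_le_Cmod (u (S m) - u m)) | auto]. }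
  exists (x, y); apply is_Clim_seq_components; now split.
Qed.

(** * Second-order estimates for the exponential and the logarithm *)

Lemma Cexp_plus (v w : C) : Cexp (v + w) = Cexp v * Cexp w.
Proof.
  destruct v as [x y], w as [x' y']; unfold Cexp, Cmult; simpl.
  rewrite exp_plus, cos_plus, sin_plus; f_equal; ring.
Qed.

Lemma Cexp_RtoC (x : R) : Cexp x = exp x.
Proof. unfold Cexp, RtoC; simpl; rewrite cos_0, sin_0; f_equal; ring. Qed.

Lemma sin_le_abs (y : R) : (Rabs (sin y) <= Rabs y)%R.
Proof.
  destruct (MVT_gen sin 0 y cos) as [c [_ Hc]].
  - intros x _; auto_derive; [trivial | ring].
  - intros x _; apply continuity_sin.
  - rewrite sin_0, !Rminus_0_r in Hc; rewrite Hc, Rabs_mult.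
    generalize (COS_bound c) (Rabs_pos y); intros H1 H2.
    assert (Rabs (cos c) <= 1)%R by (apply Rabs_le; lra). nra.
Qed.

Lemma one_minus_cos_le (y : R) : (0 <= 1 - cos y <= y ^ 2 / 2)%R.
Proof.
  split; [generalize (COS_bound y); lra|].
  replace (cos y) with (cos (2 * (y / 2)))%R by (f_equal; field).
  rewrite cos_2a_sin.
  generalize (pow_maj_Rabs _ _ 2 (sin_le_abs (y / 2))).
  rewrite pow2_abs; intros; nra.
Qed.

Lemma sin_taylor_le (y : R) : (Rabs (sin y - y) <= Rabs y ^ 3 / 2)%R.
Proof.
  destruct (MVT_gen (fun t => sin t - t)%R 0 y (fun t => cos t - 1)%R) as [c [Hc E]].
  - intros x _; auto_derive; [trivial | ring].
  - intros x _; apply continuity_pt_minus; [apply continuity_sin|].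
    apply continuity_pt_id.
  - rewrite sin_0, !Rminus_0_r in E; rewrite E, Rabs_mult.
    assert (Hcy : (Rabs c <= Rabs y)%R).
    { revert Hc; unfold Rmin, Rmax, Rabs.
      destruct (Rle_dec 0 y), (Rcase_abs c), (Rcase_abs y); lra. }
    rewrite Rabs_minus_sym, Rabs_pos_eq by apply (one_minus_cos_le c).
    assert (H : (Rabs c ^ 2 <= Rabs y ^ 2)%R)
      by (apply pow_incr; split; [apply Rabs_pos | exact Hcy]).
    rewrite (pow2_abs c) in H.
    replace (Rabs y ^ 3 / 2)%R with (Rabs y ^ 2 / 2 * Rabs y)%R by field.
    apply Rmult_le_compat_r; [apply Rabs_pos|].
    generalize (one_minus_cos_le c); lra.
Qed.

(** The upper bounds come from [1 + h <= exp h] at [h = - x], that is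
    [(1 - x) * exp x <= 1]. *)
Lemma exp_taylor_le (x : R) :
  (Rabs x <= 1 / 2)%R -> (0 <= exp x - 1 - x <= 2 * x ^ 2)%R /\ (exp x <= 2)%R.
Proof.
  intros H; apply Rabs_le_between in H.
  generalize (exp_ineq1_le x) (exp_ineq1_le (- x)) (exp_pos x).
  rewrite exp_Ropp; intros H1 H2 H3.
  assert (H4 : ((1 - x) * exp x <= 1)%R).
  { replace 1%R with (/ exp x * exp x)%R at 2 by (field; lra).
    apply Rmult_le_compat_r; lra. }
  repeat split; nra.
Qed.

(** With [w = x + i y], the real part of the error is
    [(exp x - 1 - x) - exp x (1 - cos y)] and the imaginary part is
    [(exp x - 1) sin y + (sin y - y)]; each summand is of second order. *)
Lemma Cexp_taylor_le (w : C) :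
  (Cmod w <= 1 / 2)%R -> (Cmod (Cexp w - 1 - w) <= 4 * Cmod w ^ 2)%R.
Proof.
  intros H.
  assert (Hx : (Rabs (Re w) <= 1 / 2)%R)
    by (eapply Rle_trans; [apply re_le_Cmod | exact H]).
  assert (Hy : (Rabs (Im w) <= 1 / 2)%R)
    by (eapply Rle_trans; [apply im_le_Cmod | exact H]).
  rewrite Cmod2_alt.
  eapply Rle_trans; [apply Cmod_le_components|].
  destruct w as [x y]; simpl in Hx, Hy |- *.
  destruct (exp_taylor_le x Hx) as [[E1 E2] E3].
  generalize (exp_pos x) (one_minus_cos_le y) (sin_taylor_le y) (sin_le_abs y).
  intros E4 [Y1 Y2] Y3 Y4.
  assert (R1 : (Rabs (exp x * cos y + - (1) + - x) <= 2 * x ^ 2 + y ^ 2)%R).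
  { replace (exp x * cos y + - (1) + - x)%R
      with ((exp x - 1 - x) - exp x * (1 - cos y))%R by ring.
    apply Rabs_le; split; nra. }
  assert (R2 : (Rabs (exp x * sin y + - 0 + - y) <= x ^ 2 + 2 * y ^ 2)%R).
  { replace (exp x * sin y + - 0 + - y)%R
      with ((exp x - 1) * sin y + (sin y - y))%R by ring.
    eapply Rle_trans; [apply Rabs_triang|]; rewrite Rabs_mult.
    assert (Rabs (exp x - 1) <= 2 * Rabs x)%R.
    { apply Rabs_le; revert Hx; unfold Rabs; destruct (Rcase_abs x); nra. }
    rewrite <- (pow2_abs x), <- (pow2_abs y).
    generalize (Rabs_pos x) (Rabs_pos y) (Rabs_pos (sin y)) (Rabs_pos (exp x - 1)).
    intros.
    assert (Rabs (exp x - 1) * Rabs (sin y) <= 2 * Rabs x * Rabs y)%R by nra.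
    assert (Rabs y ^ 3 <= Rabs y ^ 2)%R by nra.
    generalize (pow2_ge_0 (Rabs x - Rabs y)). nra. }
  eapply Rle_trans; [apply Rplus_le_compat; [exact R1 | exact R2]|].
  nra.
Qed.

(** Both bounds are [ln x <= x - 1], at [x = m / (m + 1)] and [x = (m + 1) / m]. *)
Lemma ln_succ_bounds (m : nat) : (0 < m)%nat ->
  (/ INR (S m) <= ln (INR (S m)) - ln (INR m) <= / INR m)%R.
Proof.
  intros Hm; assert (H : (0 < INR m)%R) by now apply lt_0_INR.
  rewrite S_INR.
  assert (ln_le_sub : forall x, (0 < x)%R -> (ln x <= x - 1)%R).
  { intros x Hx; generalize (exp_ineq1_le (ln x)); rewrite exp_ln by exact Hx; lra. }
  split.
  - generalize (ln_le_sub (INR m / (INR m + 1))%R).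
    rewrite ln_div by lra.
    replace (INR m / (INR m + 1) - 1)%R with (- / (INR m + 1))%R by (field; lra).
    intros H1; assert (0 < INR m / (INR m + 1))%R by (apply Rdiv_lt_0_compat; lra).
    lra.
  - generalize (ln_le_sub ((INR m + 1) / INR m)%R).
    rewrite ln_div by lra.
    replace ((INR m + 1) / INR m - 1)%R with (/ INR m)%R by (field; lra).
    intros H1; apply H1, Rdiv_lt_0_compat; lra.
Qed.

(** * Convergence of Euler's product and the functional equation of Gamma *)

Definition euler_term (z : C) (m : nat) : C :=
  INR (fact m) * Cexp (z * ln (INR m)) / Cprod (fun i => z + INR i) (S m).

Lemma euler_term_S (z : C) (m : nat) :
  euler_term z (S m) =
  euler_term z m *
  (INR (S m) * Cexp (z * (ln (INR (S m)) - ln (INR m))%R) / (z + INR (S m))).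
Proof.
  unfold euler_term.
  replace (z * ln (INR (S m)))
    with (z * ln (INR m) + z * (ln (INR (S m)) - ln (INR m))%R)
    by (rewrite RtoC_minus; ring).
  rewrite Cexp_plus, fact_simpl, mult_INR, RtoC_mult.
  change (Cprod (fun i => z + INR i) (S (S m)))
    with (Cprod (fun i => z + INR i) (S m) * (z + INR (S m))).
  unfold Cdiv; rewrite Cinv_mult_total; ring.
Qed.

(** With [h = ln (m + 1) - ln m] the ratio minus 1 is
    [((m + 1) (exp (z h) - 1 - z h) + z ((m + 1) h - 1)) / (z + m + 1)].
    The first term is controlled by [Cexp_taylor_le], the second by
    [ln_succ_bounds].  The bound is written as a difference so that it
    telescopes. *)
Lemma euler_ratio_bound (z : C) (m : nat) :
  (1 <= INR m)%R -> (2 * Cmod z <= INR m)%R ->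
  (Cmod (INR (S m) * Cexp (z * (ln (INR (S m)) - ln (INR m))%R) / (z + INR (S m)) - 1)
   <= (16 * Cmod z ^ 2 + 2 * Cmod z) * (/ INR m - / INR (S m)))%R.
Proof.
  intros Hm Hz.
  set (h := (ln (INR (S m)) - ln (INR m))%R).
  assert (Hh : (/ INR (S m) <= h <= / INR m)%R).
  { apply ln_succ_bounds; apply INR_lt; simpl; lra. }
  generalize (Cmod_ge_0 z); intros Hz0.
  assert (Hden : (INR (S m) / 2 <= Cmod (z + INR (S m)))%R).
  { apply Cmod_plus_INR_ge; rewrite S_INR; lra. }
  assert (HS : INR (S m) = (INR m + 1)%R) by apply S_INR.
  set (N := INR (S m)) in *.
  assert (Hnz : z + N <> 0).
  { intros E; rewrite E, Cmod_0 in Hden; lra. }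
  assert (HNm : (/ INR m - / N = / INR m * / N)%R) by (rewrite HS; field; lra).
  assert (Hi1 : (0 < / INR m)%R) by (apply Rinv_0_lt_compat; lra).
  assert (Hi2 : (0 < / N)%R) by (apply Rinv_0_lt_compat; lra).
  assert (Hi3 : (N * / N = 1)%R) by (field; lra).
  assert (Hi4 : (INR m * / INR m = 1)%R) by (field; lra).
  set (p := (/ INR m)%R) in *; set (q := (/ N)%R) in *.
  assert (Hzh : (Cmod (z * h) <= Cmod z * p)%R).
  { rewrite Cmod_mult, Cmod_R, Rabs_pos_eq by lra.
    apply Rmult_le_compat_l; lra. }
  assert (Hhalf : (Cmod (z * h) <= 1 / 2)%R) by nra.
  generalize (Cexp_taylor_le _ Hhalf) (Cmod_ge_0 (z * h)); intros HT Hzh0.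
  replace (N * Cexp (z * h) / (z + N) - 1)
    with (N * ((Cexp (z * h) - 1 - z * h) + z * (h - q)%R) / (z + N)).
  2: { unfold q; rewrite RtoC_minus, RtoC_inv by lra; field; split.
       - exact Hnz.
       - intros E; apply RtoC_inj in E; lra. }
  rewrite Cmod_div, Cmod_mult, Cmod_R, Rabs_pos_eq by (exact Hnz || lra).
  assert (HN : (Cmod (Cexp (z * h) - 1 - z * h + z * (h - q)%R)
                <= 4 * (Cmod z * p) ^ 2 + Cmod z * (p * q))%R).
  { eapply Rle_trans; [apply Cmod_triangle|].
    rewrite (Cmod_mult z), Cmod_R, Rabs_pos_eq by lra.
    apply Rplus_le_compat.
    - eapply Rle_trans; [exact HT|].
      apply Rmult_le_compat_l; [lra|]. apply pow_incr; lra.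
    - apply Rmult_le_compat_l; lra. }
  (* [8] and the final [16] are the [4] of the Taylor bound, doubled here because
     [p * p <= 2 * (p * q)] and once more because [Cmod (z + N) >= N / 2]. *)
  assert (Hpq : (p <= 2 * q)%R) by nra.
  apply Rmult_le_reg_r with (Cmod (z + N)); [lra|].
  unfold Rdiv; rewrite Rmult_assoc, Rinv_l, Rmult_1_r by lra.
  rewrite HNm.
  set (X := Cmod (Cexp _ - _ - _ + _)) in *.
  assert (HX : (X <= (8 * Cmod z ^ 2 + Cmod z) * (p * q))%R).
  { eapply Rle_trans; [exact HN|].
    assert (Cmod z ^ 2 * (p * p) <= Cmod z ^ 2 * (p * (2 * q)))%R.
    { apply Rmult_le_compat_l; [apply pow2_ge_0|].
      apply Rmult_le_compat_l; lra. }
    lra. }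
  set (K := (8 * Cmod z ^ 2 + Cmod z)%R) in *.
  replace (16 * Cmod z ^ 2 + 2 * Cmod z)%R with (2 * K)%R by (unfold K; ring).
  assert (HK : (0 <= K)%R) by (unfold K; generalize (pow2_ge_0 (Cmod z)); lra).
  assert (0 <= K * (p * q))%R
    by (apply Rmult_le_pos; [exact HK | apply Rmult_le_pos; lra]).
  nra.
Qed.

(** The ratio estimate holds from some index [N] on, so the convergence criterion
    is applied to the tail; [N > 1 + 2 * Cmod z] meets both of its hypotheses.  At a
    pole of Gamma the terms are eventually [x / 0 = 0] and the limit is 0. *)
Lemma euler_term_cvg (z : C) : exists l, is_Clim_seq (euler_term z) l.
Proof.
  destruct (INR_unbounded (1 + 2 * Cmod z)) as [N HN].
  generalize (Cmod_ge_0 z); intros Hz0.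
  set (K := (16 * Cmod z ^ 2 + 2 * Cmod z)%R).
  assert (HK : (0 <= K)%R) by (unfold K; generalize (pow2_ge_0 (Cmod z)); lra).
  assert (Hpos : forall m, (1 + 2 * Cmod z <= INR (m + N))%R).
  { intros m; rewrite plus_INR; generalize (pos_INR m); lra. }
  assert (Hinv : forall m, (0 <= / INR (m + N))%R).
  { intros m; apply Rlt_le, Rinv_0_lt_compat; specialize (Hpos m); lra. }
  assert (Hdec : forall m, (/ INR (S m + N) <= / INR (m + N))%R).
  { intros m; apply Rinv_le_contravar; [specialize (Hpos m); lra|].
    apply le_INR; lia. }
  destruct (near_constant_ratio_cvg (fun m => euler_term z (m + N))
              (fun m => K * / INR (m + N))%R) as [l Hl].
  - replace (Finite 0) with (Finite (K * 0)) by (f_equal; ring).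
    apply is_lim_seq_mult'; [apply is_lim_seq_const|].
    apply (is_lim_seq_incr_n (fun m => / INR m)%R).
    apply is_lim_seq_inv_INR.
  - intros m; apply Rmult_le_pos; auto.
  - intros m; apply Rmult_le_compat_l; auto.
  - intros m; change (S m + N)%nat with (S (m + N)).
    rewrite euler_term_S; set (r := (_ / _)).
    replace (euler_term z (m + N) * r - euler_term z (m + N))
      with (euler_term z (m + N) * (r - 1)) by ring.
    rewrite Cmod_mult; apply Rmult_le_compat_l; [apply Cmod_ge_0|].
    rewrite <- Rmult_minus_distr_l.
    apply euler_ratio_bound; specialize (Hpos m); lra.
  - exists l; now apply (is_Clim_seq_incr_n _ N).
Qed.

(** The products at [z] and [z + 1] share all factors but the first and the last,
    and [m ^ (z + 1) = m ^ z * m].  The factor [(z + 1 + m) / m] is written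
    [1 + (z + 1) / m] to show that it tends to 1. *)
Lemma euler_term_shift (z : C) (m : nat) :
  z <> 0 -> (0 < m)%nat -> z + 1 + INR m <> 0 ->
  euler_term (z + 1) m * (1 + (z + 1) * (/ INR m)%R) = z * euler_term z m.
Proof.
  intros Hz Hm Hzm; unfold euler_term.
  assert (HmR : (0 < INR m)%R) by now apply lt_0_INR.
  assert (HmC : RtoC (INR m) <> 0) by (intros E; apply RtoC_inj in E; lra).
  assert (HP : Cprod (fun i => z + INR i) (S m) * (z + 1 + INR m)
               = z * Cprod (fun i => z + 1 + INR i) (S m)).
  { transitivity (Cprod (fun i => z + INR i) (S (S m))).
    - change (Cprod (fun i => z + INR i) (S (S m)))
        with (Cprod (fun i => z + INR i) (S m) * (z + INR (S m))).
      rewrite INR_S_C; ring.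
    - rewrite Cprod_shift; f_equal; [apply Cplus_0_r|].
      apply Cprod_ext; intros i; rewrite INR_S_C; ring. }
  assert (HI : / Cprod (fun i => z + INR i) (S m)
               = / z * (z + 1 + INR m) * / Cprod (fun i => z + 1 + INR i) (S m)).
  { apply (f_equal Cinv) in HP; rewrite !Cinv_mult_total in HP.
    transitivity (/ Cprod (fun i => z + INR i) (S m) * / (z + 1 + INR m)
                  * (z + 1 + INR m)); [| rewrite HP; ring].
    now rewrite <- Cmult_assoc, Cinv_l, Cmult_1_r. }
  unfold Cdiv; rewrite HI.
  replace ((z + 1) * ln (INR m)) with (z * ln (INR m) + RtoC (ln (INR m))) by ring.
  rewrite Cexp_plus, Cexp_RtoC, exp_ln, RtoC_inv by lra.
  set (P := / Cprod _ _); field; now split.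
Qed.

Lemma Gamma_succ (z : C) : z <> 0 -> Gamma (z + 1) = z * Gamma z.
Proof.
  intros Hz.
  destruct (euler_term_cvg z) as [l Hl], (euler_term_cvg (z + 1)) as [l' Hl'].
  assert (E : Gamma z = l) by exact (is_Clim_seq_Clim_seq _ _ Hl).
  assert (E' : Gamma (z + 1) = l') by exact (is_Clim_seq_Clim_seq _ _ Hl').
  rewrite E, E'.
  destruct (INR_unbounded (2 * Cmod (z + 1))) as [N HN].
  generalize (Cmod_ge_0 (z + 1)); intros Hz0.
  apply (is_Clim_seq_unique (fun m => z * euler_term z (m + N))).
  2: now apply is_Clim_seq_scal, is_Clim_seq_incr_n.
  replace l' with (l' * (1 + (z + 1) * 0)) by ring.
  apply is_Clim_seq_ext with
    (fun m => euler_term (z + 1) (m + N) * (1 + (z + 1) * (/ INR (m + N))%R)).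
  - intros m.
    assert (Hm : (INR N <= INR (m + N))%R) by (apply le_INR; lia).
    apply euler_term_shift; [exact Hz | apply INR_lt; simpl; lra |].
    intros H0; generalize (Cmod_plus_INR_ge (z + 1) (m + N) ltac:(lra)).
    rewrite H0, Cmod_0; lra.
  - apply is_Clim_seq_mult; [now apply is_Clim_seq_incr_n|].
    apply is_Clim_seq_plus; [apply is_Clim_seq_const|].
    apply is_Clim_seq_scal.
    apply (is_Clim_seq_incr_n (fun m => RtoC (/ INR m))).
    apply is_Clim_seq_RtoC, is_lim_seq_inv_INR.
Qed.

(** * Contiguous values of the summand and its two recurrences *)

Lemma rising_succ (x y : C) : x + y <> 0 -> rising x (y + 1) = (x + y) * rising x y.
Proof.
  intros H; unfold rising, Cdiv; rewrite Cplus_assoc, Gamma_succ by exact H; ring.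
Qed.

Lemma rising_base_succ (x y : C) : x <> 0 -> x + y <> 0 ->
  x * rising (x + 1) y = (x + y) * rising x y.
Proof.
  intros Hx Hxy; unfold rising, Cdiv.
  replace (x + 1 + y) with (x + y + 1) by ring.
  rewrite !Gamma_succ, Cinv_mult_total by assumption.
  set (g := / Gamma x); now field.
Qed.

(** The inverse form is the one that occurs in [F]: raising [n] or [a] raises the
    base of a rising factorial in the denominator. *)
Lemma Cinv_rising_base_succ (x y : C) : x <> 0 -> x + y <> 0 ->
  / rising (x + 1) y = x / (x + y) * / rising x y.
Proof.
  intros Hx Hxy; generalize (rising_base_succ x y Hx Hxy); intros E.
  apply (f_equal Cinv) in E; rewrite !Cinv_mult_total in E.
  unfold Cdiv; rewrite <- Cmult_assoc, <- E, Cmult_assoc, Cinv_r by exact Hx; ring.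
Qed.

(** The linear factors that appear when [n], [a] or [k] moves by 1 do not vanish.
    Each of them is the argument of a Gamma function in [F], so the condition
    follows from [F_regular]. *)
Definition F_generic (b c d e f n a : C) : Prop :=
  n <> 0 /\ n + a <> 0 /\
  forall k : nat, d + (INR k + a) <> 0 /\ b + (INR k + e) <> 0 /\
    n + a + (INR k + f) <> 0 /\ n + (INR k + c) <> 0.

Lemma not_Gamma_pole_neq0 (z : C) : not_Gamma_pole z -> z <> 0.
Proof. intros H E; apply (H 0%nat); rewrite E; simpl; ring. Qed.

Lemma F_regular_generic (b c d e f n a : C) :
  F_regular b c d e f n a -> F_generic b c d e f n a.
Proof.
  intros H; repeat split; apply not_Gamma_pole_neq0; try apply (H k); apply (H 0%nat).
Qed.

Lemma F_succ_k (b c d e f n a : C)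
  (gen : F_generic b c d e f n a) (k : nat) :
  F b c d e f n (S k) a =
  (a + d + INR k) * (b + e + INR k) / ((n + a + f + INR k) * (n + c + INR k))
  * F b c d e f n k a.
Proof.
  destruct gen as [_ [_ H]]; destruct (H k) as [H1 [H2 [H3 H4]]].
  unfold F; rewrite INR_S_C.
  replace (INR k + 1 + a) with (INR k + a + 1) by ring.
  replace (INR k + 1 + e) with (INR k + e + 1) by ring.
  replace (INR k + 1 + f) with (INR k + f + 1) by ring.
  replace (INR k + 1 + c) with (INR k + c + 1) by ring.
  rewrite !rising_succ by assumption.
  unfold Cdiv; rewrite !Cinv_mult_total.
  replace (a + d + INR k) with (d + (INR k + a)) by ring.
  replace (b + e + INR k) with (b + (INR k + e)) by ring.
  replace (n + a + f + INR k) with (n + a + (INR k + f)) by ring.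
  replace (n + c + INR k) with (n + (INR k + c)) by ring.
  ring.
Qed.

Lemma F_succ_n (b c d e f n a : C)
  (gen : F_generic b c d e f n a) (k : nat) :
  F b c d e f (n + 1) k a =
  (n + a) * n / ((n + a + f + INR k) * (n + c + INR k)) * F b c d e f n k a.
Proof.
  destruct gen as [Hn [Hna H]]; destruct (H k) as [_ [_ [H3 H4]]].
  unfold F, Cdiv.
  replace (n + 1 + a) with (n + a + 1) by ring.
  rewrite !Cinv_mult_total, !Cinv_rising_base_succ by assumption.
  replace (n + a + f + INR k) with (n + a + (INR k + f)) by ring.
  replace (n + c + INR k) with (n + (INR k + c)) by ring.
  unfold Cdiv; ring.
Qed.

Lemma F_succ_a (b c d e f n a : C)
  (gen : F_generic b c d e f n a) (k : nat) :
  F b c d e f n k (a + 1) =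
  (n + a) * (a + d + INR k) / (n + a + f + INR k) * F b c d e f n k a.
Proof.
  destruct gen as [Hn [Hna H]]; destruct (H k) as [H1 [_ [H3 H4]]].
  unfold F, Cdiv.
  replace (n + (a + 1)) with (n + a + 1) by ring.
  replace (INR k + (a + 1)) with (INR k + a + 1) by ring.
  rewrite rising_succ, !Cinv_mult_total, Cinv_rising_base_succ by assumption.
  replace (n + a + f + INR k) with (n + a + (INR k + f)) by ring.
  replace (a + d + INR k) with (d + (INR k + a)) by ring.
  unfold Cdiv; ring.
Qed.

(** By the three shift lemmas both sides are rational multiples of [F (n, k, a)];
    [Rcoef] is Zeilberger's certificate for the resulting identity. *)
Lemma F_recurrence_n (b c d e f n a : C)
  (gen : F_generic b c d e f n a) (k : nat) :
  p1 b c d e f n a * F b c d e f (n + 1) k a + p2 b c d e f n a * F b c d e f n k a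
  = G b c d e f n (S k) a - G b c d e f n k a.
Proof.
  unfold G; rewrite F_succ_n, F_succ_k by exact gen; unfold p1, p2, Rcoef; rewrite INR_S_C.
  destruct gen as [Hn [Hna H]]; destruct (H k) as [_ [_ [H3 H4]]].
  set (X := F _ _ _ _ _ _ _ _).
  replace (n + a + (INR k + f)) with (n + a + f + INR k) in H3 by ring.
  replace (n + (INR k + c)) with (n + c + INR k) in H4 by ring.
  field; now split.
Qed.

Lemma F_recurrence_a (b c d e f n a : C)
  (gen : F_generic b c d e f n a) (k : nat) :
  p3 b c d e f n a * F b c d e f n k (a + 1) + p4 b c d e f n a * F b c d e f n k a
  = calG b c d e f n (S k) a - calG b c d e f n k a.
Proof.
  unfold calG; rewrite F_succ_a, F_succ_k by exact gen; unfold p3, p4, calR; rewrite INR_S_C.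
  destruct gen as [Hn [Hna H]]; destruct (H k) as [_ [_ [H3 H4]]].
  set (X := F _ _ _ _ _ _ _ _).
  replace (n + a + (INR k + f)) with (n + a + f + INR k) in H3 by ring.
  replace (n + (INR k + c)) with (n + c + INR k) in H4 by ring.
  field; now split.
Qed.

(** * Summation over k and iteration of the recurrence *)

(** The partial sums of the left-hand side are [g (m + 1) - g 0]. *)
Lemma telescoped_sum (u v g : nat -> C) (p q : C) :
  (forall k, p * u k + q * v k = g (S k) - g k) ->
  ex_Cseries u -> ex_Cseries v -> is_Clim_seq g 0 ->
  p * CSeries u + q * CSeries v = - g 0%nat.
Proof.
  intros Hrec Hu Hv Hg.
  apply CSeries_correct in Hu; apply CSeries_correct in Hv.
  apply (is_Clim_seq_unique
    (fun m => p * sum_n (G := C_NormedModule) u m + q * sum_n (G := C_NormedModule) v m)).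
  - apply is_Clim_seq_plus; apply is_Clim_seq_scal; assumption.
  - replace (- g 0%nat) with (0 + - g 0%nat) by ring.
    apply is_Clim_seq_ext with (fun m => g (m + 1)%nat + - g 0%nat).
    + intros m; rewrite Nat.add_1_r.
      induction m as [|m IH].
      * rewrite !sum_O, Hrec; ring.
      * rewrite !sum_Sn.
        change (@plus C_NormedModule) with Cplus.
        transitivity (g (S m) + - g 0%nat + (g (S (S m)) - g (S m))); [ring|].
        rewrite IH, <- Hrec; ring.
    + apply is_Clim_seq_plus; [| apply is_Clim_seq_const].
      now apply is_Clim_seq_incr_n.
Qed.

Lemma solve_linear (p q x y r : C) : q <> 0 ->
  p * x + q * y = - r -> y = - (r / q) + - (p / q) * x.
Proof.
  intros Hq E.
  replace r with (- (p * x + q * y)) by (rewrite E; ring).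
  now field.
Qed.

(** Unfolding the recurrence [m + 1] times gives the exact remainder
    [Cprod w (m + 1) * x (m + 1)] of the [m]-th partial sum. *)
Lemma iterated_recurrence (x h w : nat -> C) :
  (forall j, x j = h j + w j * x (S j)) ->
  is_Clim_seq (fun m => Cprod w (S m) * x (S m)) 0 ->
  is_Cseries (fun j => Cprod w j * h j) (x 0%nat).
Proof.
  intros Hx Hlim.
  apply (is_Clim_seq_ext
    (fun m => x 0%nat + - (1) * (Cprod w (S m) * x (S m)))).
  - intros m; induction m as [|m IH].
    + rewrite sum_O, (Hx 0%nat) at 1; simpl; ring.
    + rewrite sum_Sn, <- IH.
      change (@plus C_NormedModule) with Cplus.
      rewrite (Hx (S m)); change (Cprod w (S (S m))) with (Cprod w (S m) * w (S m)); ring.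
  - generalize (is_Clim_seq_plus _ _ _ _ (is_Clim_seq_const (x 0%nat))
                  (is_Clim_seq_scal (- (1)) _ _ Hlim)).
    now rewrite Cmult_0_r, Cplus_0_r.
Qed.

(** One step of the pattern (1, 1): first [n], then [a], is raised.  The second
    recurrence is used at [n + 1], which is why its hypotheses sit there. *)
Lemma frakf_step (b c d e f n a : C) :
  F_regular b c d e f n a -> F_regular b c d e f (n + 1) a ->
  p2 b c d e f n a <> 0 -> p4 b c d e f (n + 1) a <> 0 ->
  ex_Cseries (fun k => F b c d e f n k a) ->
  ex_Cseries (fun k => F b c d e f (n + 1) k a) ->
  ex_Cseries (fun k => F b c d e f (n + 1) k (a + 1)) ->
  is_Clim_seq (fun k => G b c d e f n k a) 0 ->
  is_Clim_seq (fun k => calG b c d e f (n + 1) k a) 0 ->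
  frakf b c d e f n a =
  g5 b c d e f n a + g6 b c d e f n a * frakf b c d e f (n + 1) (a + 1).
Proof.
  intros R0 R1 P2 P4 S0 S1 S2 L0 L1.
  apply F_regular_generic in R0; apply F_regular_generic in R1.
  assert (E1 := solve_linear _ _ _ _ _ P2
    (telescoped_sum _ _ _ _ _ (F_recurrence_n _ _ _ _ _ _ _ R0) S1 S0 L0)).
  assert (E2 := solve_linear _ _ _ _ _ P4
    (telescoped_sum _ _ _ _ _ (F_recurrence_a _ _ _ _ _ _ _ R1) S2 S1 L1)).
  unfold frakf, g5, g6, g1, g2, g3, g4.
  rewrite E1, E2 at 1; ring.
Qed.

Theorem theorem3 (a b c d e f n : C)
  (regular_F : forall j : nat,
     F_regular b c d e f (n + INR j) (a + INR j) /\
     F_regular b c d e f (n + INR j + 1) (a + INR j))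
  (p2_neq0 : forall j : nat, p2 b c d e f (n + INR j) (a + INR j) <> 0)
  (p4_neq0 : forall j : nat, p4 b c d e f (n + INR j + 1) (a + INR j) <> 0)
  (cvg_F : forall j : nat,
     ex_Cseries (fun k => F b c d e f (n + INR j) k (a + INR j)) /\
     ex_Cseries (fun k => F b c d e f (n + INR j + 1) k (a + INR j)))
  (lim_G : forall j : nat,
     is_Clim_seq (fun k => G b c d e f (n + INR j) k (a + INR j)) 0)
  (lim_calG : forall j : nat,
     is_Clim_seq (fun k => calG b c d e f (n + INR j + 1) k (a + INR j)) 0)
  (lim_remainder :
     is_Clim_seq (fun m =>
       Cprod (fun i => g6 b c d e f (n + INR i) (a + INR i)) (S m) *
       frakf b c d e f (n + INR m + 1) (a + INR m + 1)) 0) :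
  is_Cseries (fun j =>
    Cprod (fun i => g6 b c d e f (n + INR i) (a + INR i)) j *
    g5 b c d e f (n + INR j) (a + INR j))
    (frakf b c d e f n a).
Proof.
  assert (shift : forall (x : C) (j : nat), x + INR (S j) = x + INR j + 1)
    by (intros; rewrite INR_S_C; ring).
  replace (frakf b c d e f n a) with (frakf b c d e f (n + INR 0) (a + INR 0))
    by (f_equal; apply Cplus_0_r).
  apply (iterated_recurrence
    (fun j => frakf b c d e f (n + INR j) (a + INR j))
    (fun j => g5 b c d e f (n + INR j) (a + INR j))
    (fun i => g6 b c d e f (n + INR i) (a + INR i))).
  - intros j; generalize (proj1 (cvg_F (S j))); rewrite !shift; intros S2.
    destruct (regular_F j), (cvg_F j); apply frakf_step; auto.
  - refine (is_Clim_seq_ext _ _ _ _ lim_remainder).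
    intros m; cbv beta; now rewrite !shift.
Qed.
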